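(* Let $k\ge 1$ be an integer and let $G$ be a finite abelian group with primary decomposition $G\cong\bigoplus_i (\mathbb{Z}_{p_i^{r_i}})^{d_i}$, where the pairs $(p_i,r_i)$ are pairwise distinct and $d_i\ge1$. Suppose there is an index $i$ with $d_i=1$ (i.e. a cyclic summand $\mathbb{Z}_{p^{r}}$, $p=p_i$, $r=r_i$, of multiplicity one) such that either $p=2$ (and $k$ arbitrary), or $p=3$ and $k$ is odd. Then the restricted wreath product $G\wr\mathbb{Z}^k$ has the $R_\infty$ property, i.e. every automorphism $\varphi$ of $G\wr\mathbb{Z}^k$ has infinite Reidemeister number $R(\varphi)=\infty$.
   Context: For a group $\Gamma$ and an automorphism $\varphi:\Gamma\to\Gamma$, the Reidemeister (twisted conjugacy) classes of $\varphi$ are the classes of the equivalence relation $x\sim gx\varphi(g^{-1})$ ($g\in\Gamma$), and the Reidemeister number $R(\varphi)$ is the number of these classes (possibly infinite). A group has the $R_\infty$ property if every automorphism of it has $R(\varphi)=\infty$. The restricted wreath product $G\wr\mathbb{Z}^k$ is the semidirect product $\Sigma\rtimes_\alpha\mathbb{Z}^k$, where $\Sigma=\bigoplus_{x\in\mathbb{Z}^k}G_x$ is the direct sum of copies $G_x\cong G$ and $\mathbb{Z}^k$ acts by shifting indices: $\alpha(x)(g_y)=g_{x+y}$. *)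

(* Defs.v *)
From HB Require Import structures.
From mathcomp Require Import all_boot all_order all_algebra all_fingroup all_solvable.
From Stdlib Require Import List.
Set Implicit Arguments. Unset Strict Implicit. Unset Printing Implicit Defensive.
Import GRing.Theory.

(* Restricted wreath product  G wr Z^k  for a finite group G : {group gT}.
   Z^k is modelled by 'rV[int]_k.  An element is a pair (f, x) where
   f : Z^k -> gT is finitely supported with values in G (an element of the
   direct sum of copies G_y, f y being the y-coordinate) and x : Z^k.
   The shift action is alpha(x)(g)(z) = g (z - x), so that the copy at y is
   moved to x + y, and the product is
       (f, x) * (g, y) = (f * alpha(x)(g), x + y). *)

Section Wreath.
Variables (gT : finGroupType) (k : nat).

Definition Zk := 'rV[int]_k.

Definition wcarrier := ((Zk -> gT) * Zk)%type.

Definition wr_mem (G : {group gT}) (w : wcarrier) : Prop :=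
  (forall z, w.1 z \in G) /\
  exists s : list Zk, forall z, w.1 z != 1%g -> z \in s.

Definition wmul (a b : wcarrier) : wcarrier :=
  ((fun z => (a.1 z * b.1 (z - a.2)%R)%g), (a.2 + b.2)%R).

Definition winv (a : wcarrier) : wcarrier :=
  ((fun z => ((a.1 (z + a.2)%R)^-1)%g), (- a.2)%R).

Definition wr_aut (G : {group gT}) (phi : wcarrier -> wcarrier) : Prop :=
  [/\ (forall w, wr_mem G w -> wr_mem G (phi w)),
      (forall w1 w2, wr_mem G w1 -> wr_mem G w2 -> phi w1 = phi w2 -> w1 = w2),
      (forall w, wr_mem G w -> exists v, wr_mem G v /\ phi v = w) &
      (forall a b, wr_mem G a -> wr_mem G b -> phi (wmul a b) = wmul (phi a) (phi b))].

Definition twisted_conj (G : {group gT}) (phi : wcarrier -> wcarrier) (x y : wcarrier) : Prop :=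
  exists g, wr_mem G g /\ y = wmul (wmul g x) (phi (winv g)).

Definition reidemeister_infinite (G : {group gT}) (phi : wcarrier -> wcarrier) : Prop :=
  ~ exists s : list wcarrier,
      forall x, wr_mem G x -> exists y, In y s /\ wr_mem G y /\ twisted_conj G phi x y.

Definition R_infinity_wr (G : {group gT}) : Prop :=
  forall phi, wr_aut G phi -> reidemeister_infinite G phi.

End Wreath.

(* Main.v *)
(* The base group [S] of the wreath product consists of the torsion elements, so
   an automorphism [Phi] induces [A] in [GL_k(Z)] on the quotient and an
   [A]-semilinear automorphism [phi] of [S = V[Z^k]].  If [R(Phi)] is finite,
   then [det (1 - A) <> 0] and the cokernel of [1 - phi] on [S] is finite.
   Reducing exponents modulo [N] shows that [phi] then has finitely many fixed
   points on [S], so the cokernel of [1 - phi] on the [p^r]-torsion of [S] is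
   finite too.  As [Z_(p^r)] has multiplicity one, reading off its coordinate
   modulo [p] turns that torsion subgroup into the rank one module [F_p[Z^k]],
   on which [phi] acts as [e_z |-> c e_(A z + m)], the units of [F_p[Z^k]] being
   monomials.  Every orbit of [z |-> A z + m] on which [c^n] depends only on the
   point reached carries a [phi]-invariant functional.  There are infinitely
   many such orbits: the map is conjugate over the rationals to [A], so orbits
   can be rescaled; and if [c = -1], then the absence of a suitable orbit would
   give [A] odd order, which for odd [k] contradicts [det (1 - A) <> 0]. *)

From HB Require Import structures.
Require Import Defs.
From mathcomp Require Import all_boot all_order all_algebra all_fingroup all_solvable.
From mathcomp Require Import finmap.
From mathcomp.multinomials Require Import monalg.
From mathcomp Require Import ring zify.
From Stdlib Require Import Classical IndefiniteDescription FunctionalExtensionality.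
Set Implicit Arguments. Unset Strict Implicit. Unset Printing Implicit Defensive.

(** * The Ulm invariant of the cyclic summand *)

Section Ulm.
Local Open Scope group_scope.
Variables (gT : finGroupType) (p r : nat).
Hypotheses (p_pr : prime p) (r_gt0 : (0 < r)%N).

(** If the order of [x] is prime to [p], then [y] is trivial. If it is [p ^ e] with [e < r], then
    [y] itself can serve as [c]. If it is [p ^ e] with [e > r], all [p ^ r]-torsion consists of
    [p]-th powers. *)
Lemma cycle_split_torsion (x y : gT) :
  #[x] = (pdiv #[x] ^ logn (pdiv #[x]) #[x])%N -> (1 < #[x])%N ->
  #[x] != (p ^ r)%N -> y \in <[x]> -> y ^+ (p ^ r) = 1 ->
  exists c d, [/\ c \in <[x]>, d \in <[x]>, y = c * d ^+ p & c ^+ (p ^ r.-1) = 1].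
Proof.
set q := pdiv _; set e := logn _ _ => ox ox1 oxr /cycleP [j ->] yr.
have q_pr : prime q by apply: pdiv_prime.
have [qp|qp] := eqVneq q p; last first.
  exists 1, 1; rewrite !group1 !expg1n mulg1; split=> //.
  apply/eqP; rewrite -order_eq1 -dvdn1.
  have /eqP <- : coprime (q ^ e) (p ^ r).
    by rewrite coprimeXl // coprimeXr // prime_coprime // dvdn_prime2.
  by rewrite dvdn_gcd -ox orderXdvd order_dvdn yr /=.
have e_r : e != r by apply: contraNneq oxr => <-; rewrite ox qp.
have [lt_er|lt_re|//] := ltngtP e r; last by move=> er; rewrite er eqxx in e_r.
  exists (x ^+ j), 1; rewrite mem_cycle group1 expg1n mulg1; split=> //.
  rewrite -expgM mulnC expgM; apply/eqP.
  suff /eqP -> : x ^+ (p ^ r.-1) == 1 by rewrite expg1n.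
  rewrite -order_dvdn ox qp dvdn_exp2l // -ltnS prednK //.
exists 1, (x ^+ (j %/ p)); rewrite mem_cycle group1 expg1n mul1g; split=> //.
rewrite -expgM divnK //.
move/eqP: yr; rewrite -expgM -order_dvdn ox qp => dv.
have : (p ^ r.+1 %| j * p ^ r)%N by apply: dvdn_trans dv; rewrite dvdn_exp2l.
by rewrite expnS dvdn_pmul2r // expn_gt0 prime_gt0.
Qed.

Lemma dprod_split_torsion (b : seq gT) (H : {group gT}) :
  \big[dprod/1]_(x <- b) <[x]> = H ->
  {in b, forall x, [/\ #[x] = (pdiv #[x] ^ logn (pdiv #[x]) #[x])%N, (1 < #[x])%N &
    #[x] != (p ^ r)%N]} ->
  forall h, h \in H -> h ^+ (p ^ r) = 1 ->
  exists c d, [/\ c \in H, d \in H, h = c * d ^+ p & c ^+ (p ^ r.-1) = 1].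
Proof.
elim: b H => [|x b IH] H.
  rewrite big_nil => <- _ h /set1P -> _.
  by exists 1, 1; rewrite !group1 !expg1n mulg1.
rewrite big_cons => /dprodP [[K H' defK defH'] KH' cKH tiKH] ord h hH hr.
rewrite -KH' in hH; case/mulsgP: hH => y h' yK h'H' eh; rewrite {h}eh in hr *.
rewrite defH' in cKH tiKH h'H' KH'.
have comm u v : u \in <[x]> -> v \in H' -> commute u v.
  by move=> ux vH; apply: commute_sym; apply: (centsP cKH).
rewrite (expgMn _ (comm _ _ yK h'H')) in hr.
have yr : y ^+ (p ^ r) = 1.
  (* The power [y ^+ (p ^ r)] is the inverse of a power of [h'], so it lies in both factors and is
     trivial. *)
  apply/set1gP; rewrite -tiKH inE groupX ?yK //=.
  by move/(canRL (mulgK _)): hr; rewrite mul1g => ->; rewrite groupV groupX.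
have h'r : h' ^+ (p ^ r) = 1 by rewrite yr mul1g in hr.
have [c [d [cx dx -> cr]]] : exists c d,
    [/\ c \in <[x]>, d \in <[x]>, y = c * d ^+ p & c ^+ (p ^ r.-1) = 1].
  by case: (ord x (mem_head _ _)) => *; apply: cycle_split_torsion.
have [c' [d' [c'x d'x -> c'r]]] : exists c d,
    [/\ c \in H', d \in H', h' = c * d ^+ p & c ^+ (p ^ r.-1) = 1].
  by apply: IH => // z zb; apply: ord; rewrite inE zb orbT.
exists (c * c'), (d * d'); rewrite -KH' !mem_mulg //; split=> //.
  rewrite (expgMn _ (comm _ _ dx d'x)) !mulgA -[c * d ^+ p * c']mulgA.
  by rewrite (comm (d ^+ p) c') ?groupX // !mulgA.
by rewrite (expgMn _ (comm _ _ cx c'x)) cr c'r mulg1.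
Qed.

(* [lam] is the coordinate on the multiplicity-one summand, modulo [p]. The last
   two clauses describe its kernel on the [p^r]-torsion without reference to the
   decomposition, so that automorphisms of direct sums of copies of [G] preserve it. *)
Lemma exists_ulm_coordinate (G : {group gT}) (b : seq gT) :
  \big[dprod/1]_(x <- b) <[x]> = G -> abelian G ->
  all (fun x => (1 < #[x])%N && (#[x] == (pdiv #[x]) ^ (logn (pdiv #[x]) #[x]))%N) b ->
  count (fun x => #[x] == p ^ r)%N b = 1%N ->
  exists (lam : gT -> 'F_p) (a : gT),
    [/\ [/\ a \in G, lam a = 1%R & a ^+ (p ^ r) = 1],
        {in G &, forall g h, lam (g * h) = (lam g + lam h)%R},
        {in G, forall g, g ^+ (p ^ r.-1) = 1 -> lam g = 0%R} &
        {in G, forall g, g ^+ (p ^ r) = 1 -> lam g = 0%R ->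
          exists c d, [/\ c \in G, d \in G, g = c * d ^+ p & c ^+ (p ^ r.-1) = 1]}].
Proof.
move=> defG abG /allP ordb cnt.
have /hasP [x xb /eqP ox] : has (fun x => #[x] == p ^ r)%N b by rewrite has_count cnt.
have bperm := perm_to_rem xb.
have ord' : {in rem x b, forall z, [/\ #[z] = (pdiv #[z] ^ logn (pdiv #[z]) #[z])%N,
   (1 < #[z])%N & #[z] != (p ^ r)%N]}.
  move=> z zb; have /andP [z1 /eqP oz] := ordb z (mem_rem zb); split=> //.
  move: cnt; rewrite (seq.permP bperm) /= ox eqxx => -[] /eqP.
  by rewrite -leqn0 leqNgt -has_count => /hasPn /(_ z zb).
move: defG; rewrite (perm_big _ bperm) big_cons.
case/dprodP => [[K H defK defH] KH cKH tiKH].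
rewrite defH in cKH tiKH KH.
have comm : {in G &, forall u v, commute u v}.
  by move=> u v uG vG; apply: (centsP abG).
have xG : x \in G by rewrite -KH; apply/(subsetP (mulG_subl _ _))/cycle_id.
have HG : H \subset G by rewrite -KH mulG_subr.
have HGP h : h \in H -> h \in G by apply/subsetP.
have xnG n : x ^+ n \in G by apply: groupX.
have coord g : exists n, g \in G -> exists2 h, h \in H & g = x ^+ n * h.
  have [|gG] := boolP (g \in G); last by exists 0%N.
  rewrite -{1}KH => /mulsgP [_ h /cycleP [n ->] hH ->].
  by exists n => _; exists h.
have [nu nuP] := functional_choice _ coord.
pose lam g : 'F_p := (nu g)%:R%R.
have p_gt1 := prime_gt1 p_pr.
(* The exponent of [x] is determined modulo [p ^ r], hence modulo [p] because [r] is positive. *)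
have lamE n h : h \in H -> lam (x ^+ n * h) = n%:R%R.
  move=> hH; have [|h' h'H e] := nuP (x ^+ n * h); first by rewrite groupM ?xnG ?HGP.
  have : x ^+ n == x ^+ nu (x ^+ n * h).
    rewrite eq_mulVg1 -in_set1; have -> : [set 1] = 1 :> {set gT} by [].
    rewrite -tiKH inE groupM ?groupV ?mem_cycle //=.
    have -> : (x ^+ n)^-1 * x ^+ nu (x ^+ n * h) = h * h'^-1.
      by apply: (canRL (mulgK _)); rewrite -mulgA -e mulKg.
    by rewrite groupM ?groupV.
  rewrite eq_expg_mod_order ox => /eqP e'; apply/val_inj.
  rewrite /lam /= !val_Fp_nat //.
  have dv : (p %| p ^ r)%N by rewrite dvdn_exp.
  by rewrite -(modn_dvdm n dv) e' modn_dvdm.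
have Fp0 n : n%:R%R == 0%R :> 'F_p -> (p %| n)%N.
  by move/eqP/(congr1 val); rewrite /= val_Fp_nat // => /eqP.
exists lam, x; split.
- by split=> //; [rewrite -[x]mulg1 -{1}(expg1 x) lamE | rewrite -ox expg_order].
- move=> g h gG hG; have [g' g'H eg] := nuP g gG; have [h' h'H eh] := nuP h hG.
  have -> : g * h = x ^+ (nu g + nu h) * (g' * h').
    rewrite {1}eg {1}eh expgD !mulgA; congr (_ * _); rewrite -!mulgA; congr (_ * _).
    by apply: comm; rewrite ?xnG ?HGP.
  by rewrite lamE ?groupM // GRing.natrD.
- move=> g gG; have [h hH ->] := nuP g gG => e; rewrite lamE //.
  rewrite expgMn in e; last by apply: comm; rewrite ?xnG ?HGP.
  have : x ^+ nu g ^+ (p ^ r.-1) == 1.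
    rewrite -in_set1; have -> : [set 1] = 1 :> {set gT} by [].
    rewrite -tiKH inE -expgM mem_cycle /= expgM.
    by move/(canRL (mulgK _)): e; rewrite mul1g => ->; rewrite groupV groupX.
  rewrite -expgM -order_dvdn ox -{1}(prednK r_gt0) expnS dvdn_pmul2r; last first.
    by rewrite expn_gt0 prime_gt0.
  case/dvdnP => l ->; apply/val_inj; rewrite /= val_Fp_nat //.
  by rewrite modnMl.
move=> g gG; have [h hH ->] := nuP g gG => e.
rewrite lamE // => /eqP /Fp0 pn.
rewrite expgMn in e; last by apply: comm; rewrite ?xnG ?HGP.
have hr : h ^+ (p ^ r) = 1.
  by move: e; rewrite -expgM mulnC expgM -ox expg_order expg1n mul1g.
have [c [d [cH dH -> cr]]] := dprod_split_torsion defH ord' hH hr.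
exists c, (x ^+ (nu g %/ p) * d); split; rewrite ?groupM ?xnG ?HGP //.
rewrite expgMn; last by apply: comm; rewrite ?xnG ?HGP.
rewrite -expgM divnK // !mulgA; congr (_ * _).
by apply: comm; rewrite ?xnG ?HGP.
Qed.

End Ulm.

Import Order.TTheory GRing.Theory Num.Theory.

Section RInfinity.
Local Open Scope ring_scope.

(** * Orbits of affine maps of [Z^k] *)

Lemma dot_eq0 k (w : 'rV[int]_k) : (w *m w^T) 0 0 = 0 -> w = 0.
Proof.
rewrite mxE => /eqP.
under eq_bigr do rewrite mxE -expr2.
rewrite psumr_eq0 => [/allP h|i _]; last exact: sqr_ge0.
apply/rowP => i; rewrite mxE; apply/eqP.
by have /= := h i (mem_index_enum _); rewrite sqrf_eq0.
Qed.

Lemma dot_ge0 k (w : 'rV[int]_k) : 0 <= (w *m w^T) 0 0.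
Proof. by rewrite mxE; apply: sumr_ge0 => i _; rewrite mxE -expr2 sqr_ge0. Qed.

Lemma det_exp k (A : 'M[int]_k) n : \det (A ^+ n) = \det A ^+ n.
Proof.
elim: n => [|n IH]; first by rewrite !expr0 det1.
by rewrite !exprS -IH det_mulmx.
Qed.

Lemma det_odd_order k n (A : 'M[int]_k) : odd n -> A ^+ n = 1 -> \det A = 1.
Proof.
move=> on An1.
have /eqP : \det A ^+ n = 1 by rewrite -det_exp An1 det1.
have n0 : (0 < n)%N by case: n on {An1}.
have [d0|d0] := lerP 0 (\det A).
  by rewrite pexprn_eq1 // => /orP [/eqP n00|/eqP //]; rewrite n00 in n0.
have : \det A ^+ n < 0 by rewrite exprn_odd_lt0.
by move=> h /eqP e; rewrite e in h.
Qed.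

(* [Q = \sum_i A^i (A^i)^T] is a positive definite form preserved by [A], so
   [(1 - A) Q A^T = - Q (1 - A)^T]; in odd dimension the determinants of both
   sides have opposite signs. *)
Lemma det_1sub_odd_order k n (A : 'M[int]_k) :
  odd k -> odd n -> A ^+ n = 1 -> \det (1 - A) = 0.
Proof.
move=> ok on An1.
have n0 : (0 < n)%N by case: n on {An1}.
pose F i : 'M[int]_k := A ^+ i *m (A ^+ i)^T.
pose Q := \sum_(i < n) F i.
have AQA : A *m Q *m A^T = Q.
  rewrite /Q mulmx_sumr mulmx_suml.
  (* Conjugation sends [F i] to [F i.+1], and [F n = F 0], so the terms of [Q] are permuted
     cyclically. *)
  transitivity (\sum_(i < n) F i.+1).
    apply: eq_bigr => i _; rewrite /F mulmxA -!mulmxA -trmx_mul !mulmxA.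
    by rewrite -![_ *m _]/(_ * _) -exprS.
  case: n n0 An1 @Q {on} => // n _ An1 Q.
  rewrite big_ord_recr [RHS]big_ord_recl /= addrC; congr (_ + _).
  by rewrite /F An1 expr0.
have detQ : \det Q != 0.
  apply/det0P => -[w w0 wQ].
  have : (w *m Q *m w^T) 0 0 = 0 by rewrite wQ mul0mx mxE.
  have -> : (w *m Q *m w^T) 0 0
     = \sum_(i < n) ((w *m A ^+ i) *m (w *m A ^+ i)^T) 0 0.
    rewrite mulmx_sumr mulmx_suml summxE; apply: eq_bigr => i _.
    by rewrite /F trmx_mul !mulmxA.
  move=> /eqP; rewrite psumr_eq0 => [/allP h|i _]; last exact: dot_ge0.
  have /= /eqP := h (Ordinal n0) (mem_index_enum _).
  rewrite expr0 mulmx1 => /dot_eq0 e.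
  by rewrite e eqxx in w0.
have detN (M : 'M[int]_k) : \det (- M) = (-1) ^+ k * \det M.
  by rewrite -scaleN1r detZ.
have dA := det_odd_order on An1.
have : (1 - A) *m Q *m A^T = - (Q *m (1 - A)^T).
  by rewrite !mulmxBl AQA mul1mx linearB /= trmx1 mulmxBr mulmx1 opprB.
move/(congr1 (fun M => \det M)); rewrite detN !det_mulmx !det_tr dA.
rewrite -signr_odd ok expr1 mulr1 mulN1r => e.
have : \det Q * \det (1 - A) = 0 by move: e; rewrite mulrC; set x := _ * _; lia.
by move/eqP; rewrite mulf_eq0 (negPf detQ) => /eqP.
Qed.

Section AffineOrbits.
Variables (k : nat) (A A' : 'M[int]_k) (m : 'rV[int]_k).
Hypothesis AA' : A *m A' = 1%:M.
Hypothesis detA : \det (1%:M - A) != 0.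

Definition affine (z : 'rV[int]_k) := z *m A + m.

Let D := \det (1%:M - A).
Let mM := m *m \adj (1%:M - A).

(* [recentre x = D (x - x0)], where [x0] is the fixed point of [affine] over
   the rationals. *)
Definition recentre (x : 'rV[int]_k) := D *: x - mM.

Lemma recentre_affine x : recentre (affine x) = recentre x *m A.
Proof.
(* This is the adjugate identity: [mM / D] is the rational fixed point of [affine]. *)
have e : mM - mM *m A = D *: m.
  rewrite -[X in X - _]mulmx1 -mulmxBr /mM -mulmxA mul_adj_mx.
  by rewrite mul_mx_scalar.
rewrite /recentre /affine scalerDr mulmxBl scalemxAl -e.
by rewrite -addrA; congr (_ + _); rewrite addrAC subrr add0r.
Qed.

Lemma recentre_iter n x : recentre (iter n affine x) = recentre x *m A ^+ n.
Proof.
elim: n => [|n IH]; first by rewrite expr0 mulmx1.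
by rewrite iterS recentre_affine IH exprSr -mulmxA.
Qed.

Lemma recentre_inj : injective recentre.
Proof.
move=> x y /addIr /eqP; rewrite -subr_eq0 -scalerBr => /eqP e.
apply/rowP => j; move/rowP/(_ j)/eqP: e.
by rewrite !mxE mulf_eq0 (negPf detA) /= subr_eq0 => /eqP.
Qed.

Lemma mulmx_exp_inj n : injective (fun v : 'rV[int]_k => v *m A ^+ n).
Proof.
elim: n => [|n IH] v w /=; first by rewrite expr0 !mulmx1.
rewrite exprSr -[A ^+ n * A]/(A ^+ n *m A) !mulmxA => e; apply: IH.
by rewrite -[LHS]mulmx1 -[RHS]mulmx1 -AA' !mulmxA e.
Qed.

Lemma iter_affine_inj n : injective (iter n affine).
Proof.
move=> x y /(congr1 recentre); rewrite !recentre_iter => /mulmx_exp_inj.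
exact: recentre_inj.
Qed.

Lemma iter_fix n l x : iter n affine x = x -> iter (n * l) affine x = x.
Proof. by move=> e; elim: l => [|l IH]; rewrite ?muln0 // mulnS iterD IH. Qed.

(** Otherwise the origin and the basis vectors have a common odd period [N]. Since [recentre] turns
    [affine] into [A] and sends differences to their multiples by [D], this forces [A ^+ N = 1], and
    then [1 - A] is singular. *)
Lemma exists_no_odd_period : odd k ->
  exists x, forall n, odd n -> iter n affine x <> x.
Proof.
move=> ok; apply: NNPP => no.
have odd_period x : exists n, odd n /\ iter n affine x = x.
  apply: NNPP => nx; apply: no; exists x => n on e; apply: nx.
  by exists n.
have [n0 [on0 e0]] := odd_period 0.
have [f fP] := fin_all_exists (fun j : 'I_k => odd_period (delta_mx 0 j)).
pose N := (n0 * \prod_j f j)%N.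
have oN : odd N.
  rewrite oddM on0 /=; elim/big_ind: _ => // [a b oa ob|j _].
    by rewrite oddM oa.
  by have [] := fP j.
have N0 : iter N affine 0 = 0 by apply: iter_fix.
have Nj j : iter N affine (delta_mx 0 j) = delta_mx 0 j.
  rewrite /N (bigD1 j) //= mulnCA; have [_ e] := fP j.
  exact: iter_fix.
have AN1 : A ^+ N = 1.
  apply/row_matrixP => j; rewrite rowE rowE [RHS]mulmx1.
  have := congr1 recentre (Nj j); have := congr1 recentre N0.
  rewrite !recentre_iter /recentre scaler0 sub0r mulmxBl mulNmx => -> /addIr.
  rewrite -scalemxAl => /eqP; rewrite -subr_eq0 -scalerBr => /eqP e.
  apply/rowP => i; move/rowP/(_ i)/eqP: e.
  by rewrite !mxE mulf_eq0 (negPf detA) /= subr_eq0 => /eqP.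
have e := det_1sub_odd_order ok oN AN1.
by case/eqP: detA.
Qed.

Lemma expr_sq1 (R : pzRingType) (c : R) n : c * c = 1 -> c ^+ n = c ^+ odd n.
Proof.
move=> cc; rewrite -[in LHS](odd_double_half n) exprD -mul2n exprM expr2 cc.
by rewrite expr1n mulr1.
Qed.

Section Scaling.
Variables (x1 : 'rV[int]_k) (x1nz : recentre x1 != 0).

(* With [Q = 1 + (D e)^2 = 1 modulo D], where [e] is a nonzero entry of
   [recentre x1], scaling by [Q] preserves the image of [recentre], and [Q > |e|]
   prevents [Q] from dividing the vectors in the orbit of [recentre x1]. *)
Lemma exists_large_scaling : exists x : nat -> 'rV[int]_k, exists Q : int,
  [/\ Q != 0, forall i, recentre (x i) = Q ^+ i *: recentre x1 &
      forall l a b, recentre x1 *m A ^+ a <> Q ^+ l.+1 *: (recentre x1 *m A ^+ b)].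
Proof.
have [j e0] : exists j, recentre x1 0 j != 0.
  apply: NNPP => no; case/eqP: x1nz; apply/rowP => j; rewrite [RHS]mxE.
  by apply/eqP; apply: contraT => h; case: no; exists j.
set e := recentre x1 0 j in e0.
pose Q := 1 + (D * e) ^+ 2.
have D0 : D != 0 by [].
have ltQ : `|e| < Q.
  have h1 : 1 <= `|D| by rewrite -gtz0_ge1 normr_gt0.
  have h2 : 1 <= `|e| by rewrite -gtz0_ge1 normr_gt0.
  have -> : Q = 1 + `|D| ^+ 2 * `|e| ^+ 2 by rewrite /Q exprMn !real_normK ?num_real.
  rewrite !expr2; move: `|D| `|e| h1 h2 => d f h1 h2.
  have h3 : f <= f * f by nia.
  have h4 : 1 <= d * d by nia.
  have : f * f <= d * d * (f * f) by apply: ler_peMl => //; nia.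
  lia.
have Q0 : 0 < Q by apply: le_lt_trans ltQ; rewrite normr_ge0.
(* The correction term is the integral vector [((Q - 1) / D) *: mM], so one step is the homothety of
   ratio [Q] about the rational fixed point. *)
exists (fun i => iter i (fun x : 'rV[int]_k => Q *: x - (D * e ^+ 2) *: mM) x1), Q; split.
- by rewrite gt_eqF.
- elim=> [|i IH]; first by rewrite expr0 scale1r.
  rewrite iterS [Q ^+ i.+1]exprS -[RHS]scalerA -IH /recentre !scalerBr !scalerA.
  rewrite -addrA [D * Q]mulrC; congr (_ + _).
  rewrite -opprD -[X in _ + X]scale1r -scalerDl; congr (- (_ *: _)).
  by rewrite /Q; ring.
move=> l a b h.
have AAn n : A ^+ n *m A' ^+ n = 1%:M.
  elim: n => [|n IH]; first by rewrite !expr0 mulmx1.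
  rewrite exprSr [A' ^+ _]exprS -[A ^+ n * A]/(A ^+ n *m A).
  rewrite -[A' * A' ^+ n]/(A' *m A' ^+ n) -mulmxA [A *m _]mulmxA.
  by rewrite AA' mul1mx IH.
have h1 : recentre x1 = Q ^+ l.+1 *: (recentre x1 *m A ^+ b *m A' ^+ a).
  by rewrite scalemxAl -h -mulmxA AAn mulmx1.
have : (Q %| e)%Z.
  by rewrite /e h1 mxE exprS -mulrA dvdz_mulr.
rewrite dvdzE => /dvdn_leq; rewrite absz_gt0 => /(_ e0).
by move: ltQ; lia.
Qed.

End Scaling.

(** One good starting point suffices, since scaling [recentre] by powers of [Q] preserves
    coincidences of iterates along an orbit and separates the orbits. For [c = 1] any point that is
    not fixed will do; otherwise a point without odd period is taken, as [c ^+ n] depends only on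
    the parity of [n]. *)
Lemma infinitely_many_orbits (R : pzRingType) (c : R) :
  (0 < k)%N -> c * c = 1 -> c = 1 \/ odd k ->
  exists x : nat -> 'rV[int]_k,
    (forall i a b, iter a affine (x i) = iter b affine (x i) -> c ^+ a = c ^+ b)
    /\ (forall i j a b, iter a affine (x i) = iter b affine (x j) -> i = j).
Proof.
move=> k0 cc hc.
have [x1 [x1nz x1P]] : exists x1, recentre x1 != 0 /\
   forall a b, iter a affine x1 = iter b affine x1 -> c ^+ a = c ^+ b.
  case: (classic (c = 1)) => [-> | c1].
    have [e|n0] := eqVneq (recentre 0) 0; last first.
      by exists 0; split=> // a b _; rewrite !expr1n.
    exists (const_mx 1); split => [|a b _]; last by rewrite !expr1n.
    apply/eqP; rewrite -e => /recentre_inj/rowP/(_ (Ordinal k0)).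
    by rewrite !mxE.
  case: hc => // /exists_no_odd_period [x xP]; exists x.
  have good a b : iter a affine x = iter b affine x -> c ^+ a = c ^+ b.
    wlog leab : a b / (a <= b)%N.
      by case/orP: (leq_total a b) => h H e; [|symmetry]; apply: H.
    rewrite -(subnKC leab) iterD => /iter_affine_inj /esym e.
    rewrite exprD (expr_sq1 (b - a) cc).
    by case on: (odd (b - a)); [case: (xP _ on e) | rewrite expr0 mulr1].
  (* A point with [recentre x = 0] is fixed by [affine], which would give [c ^+ 1 = c ^+ 0]. *)
  split=> //; apply/eqP => x0; apply: c1.
  rewrite -(expr1 c) -(expr0 c); apply: good => /=; apply: recentre_inj.
  by rewrite recentre_affine x0 mul0mx.
have [x [Q [Q0 xQ xdiff]]] := exists_large_scaling x1nz.
have scaleI i : injective (fun v : 'rV[int]_k => Q ^+ i *: v).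
  move=> v w /eqP; rewrite -subr_eq0 -scalerBr => /eqP e; apply/rowP => j.
  move/rowP/(_ j)/eqP: e.
  by rewrite !mxE mulf_eq0 expf_eq0 (negPf Q0) andbF /= subr_eq0 => /eqP.
exists x; split=> [i a b /(congr1 recentre)|].
  rewrite !recentre_iter xQ -!scalemxAl => /scaleI e; apply: x1P.
  by apply: recentre_inj; rewrite !recentre_iter.
have key i j a b : (i < j)%N -> iter a affine (x i) <> iter b affine (x j).
  move=> ltij /(congr1 recentre).
  rewrite !recentre_iter !xQ -!scalemxAl -(subnKC ltij) addSnnS exprD -scalerA.
  by move=> /scaleI/xdiff.
move=> i j a b e; case: (ltngtP i j) => // h.
  by case: (key _ _ _ _ h e).
by case: (key _ _ _ _ h (esym e)).
Qed.

End AffineOrbits.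

(** * Finite quotients and fixed points *)

Section MalgExt.
Variables (K : choiceType) (V U : zmodType).

(** The universal property of the direct sum of copies of [V] indexed by [K]. *)
Definition malg_ext (F : K -> {additive V -> U}) (s : {malg V[K]}) : U :=
  \sum_(z <- msupp s) F z s@_z.

Lemma malg_extEw F (s : {malg V[K]}) (d : {fset K}) :
  (msupp s `<=` d)%fset -> malg_ext F s = \sum_(z <- d) F z s@_z.
Proof.
move=> le; rewrite /malg_ext (big_fset_incl _ le) // => z _ /mcoeff_outdom ->.
by rewrite raddf0.
Qed.

Fact malg_ext_is_additive F : additive (malg_ext F).
Proof.
move=> s t; pose d := (msupp s `|` msupp t)%fset.
rewrite (@malg_extEw F (s - t) d) ?msuppB_le //.
rewrite (@malg_extEw F s d) ?fsubsetUl // (@malg_extEw F t d) ?fsubsetUr //.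
by rewrite -sumrB; apply: eq_bigr => z _; rewrite mcoeffB raddfB.
Qed.

HB.instance Definition _ F :=
  GRing.isAdditive.Build {malg V[K]} U (malg_ext F) (malg_ext_is_additive F).

Lemma malg_extU F g z : malg_ext F << g *g z >> = F z g.
Proof.
by rewrite (@malg_extEw F _ [fset z]%fset) ?msuppU_le // big_seq_fset1 mcoeffUU.
Qed.

Lemma additive_malgP (f h : {additive {malg V[K]} -> U}) :
  (forall g z, f << g *g z >> = h << g *g z >>) -> f =1 h.
Proof.
by move=> e s; rewrite (monalgE s) !raddf_sum; apply: eq_bigr => z _; apply: e.
Qed.

End MalgExt.

(** * Kernel and cokernel of an endomorphism of a finite abelian group *)

Section CokerKer.
Variables (X : finType) (U : zmodType) (j : X -> U) (i : U -> X).
Hypotheses (jK : cancel j i) (iK : cancel i j).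
Variable theta : {additive U -> U}.

Let tX x := i (theta (j x)).

(** Nonempty fibres of [theta] are translates of its kernel. The finite type [X] serves to count the
    elements of [U]. *)
Lemma card_ker_im :
  (#|[set x | theta (j x) == 0%R]| * #|[set tX x | x : X]| = #|X|)%N.
Proof.
rewrite -[RHS]sum1_card (partition_big tX [in [set tX x | x : X]]) /=; last first.
  by move=> x _; apply: imset_f.
rewrite mulnC -sum_nat_const; apply: eq_bigr => _ /imsetP [x0 _ ->].
have inj : injective (fun x => i (j x - j x0)).
  by move=> x y /(can_inj iK)/addIr/(can_inj jK).
rewrite -sum1_card (reindex_inj inj) /=; apply: eq_bigl => x.
by rewrite inE iK raddfB subr_eq0 (inj_eq (can_inj iK)).
Qed.

(** A maximal set [C] of elements pairwise incongruent modulo the image meets every coset. So [#|X|]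
    is at most [#|C|] times the size of the image, and [card_ker_im] bounds the kernel by [#|C|]. *)
Lemma incongruent_mod_im n : (n <= #|[set x | theta (j x) == 0%R]|)%N ->
  exists r : 'I_n -> U, forall l l' w, r l - r l' = theta w -> l = l'.
Proof.
move=> le_n.
pose P (C : {set X}) :=
  [forall x in C, forall y in C, (i (j x - j y) \in codom tX) ==> (x == y)].
have P0 : P set0 by apply/forall_inP => x; rewrite inE.
case: (arg_maxnP (fun C : {set X} => #|C|) P0) => C PC maxC.
have codomP' u w : u = theta w -> i u \in codom tX.
  by move=> ->; apply/codomP; exists (i w); rewrite /tX iK.
have PCP x y w : x \in C -> y \in C -> j x - j y = theta w -> x = y.
  move=> xC yC /codomP' e; move/forall_inP: PC => /(_ x xC)/forall_inP/(_ y yC).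
  by move/implyP => h; apply/eqP/h.
have coverC u : exists x w, x \in C /\ j u = j x + theta w.
  have [uC|uC] := boolP (u \in C); first by exists u, 0; rewrite raddf0 addr0.
  apply: NNPP => no; have : P (u |: C).
    have bad x w : x \in C -> j u - j x <> theta w.
      by move=> xC e; apply: no; exists x, w; rewrite -e addrCA subrr addr0.
    apply/forall_inP => x /setU1P xC; apply/forall_inP => y /setU1P yC.
    apply/implyP => /codomP [w /(can_inj iK) e]; apply/eqP.
    case: xC yC e => [->|xC] [->|yC] // e; [by case: (bad _ _ yC e)| |].
      by case: (bad x (- j w)) => //; rewrite raddfN -e opprB.
    exact: PCP e.
  by move/maxC; rewrite cardsU1 uC add1n /= ltnn.
have leC : (n <= #|C|)%N.
  have im0 : (0 < #|[set tX x | x : X]|)%N.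
    by apply/card_gt0P; exists (tX (i 0)); apply: imset_f.
  apply: (leq_trans le_n); rewrite -(leq_pmul2r im0) card_ker_im -cardsX.
  rewrite -[leqLHS]cardsT.
  apply: leq_trans (leq_imset_card (fun p : X * X => i (j p.1 + j p.2)) _).
  apply/subset_leq_card/subsetP => u _; have [x [w [xC e]]] := coverC u.
  apply/imsetP; exists (x, tX (i w)); last by rewrite /= /tX !iK -e jK.
  by rewrite inE xC /= imset_f.
exists (fun l => j (enum_val (widen_ord leC l))) => l l' w e.
have /enum_val_inj/(congr1 val)/= ll' := PCP _ _ _ (enum_valP _) (enum_valP _) e.
exact: val_inj.
Qed.

End CokerKer.

Lemma intr_Zp_eq0 n (d : int) : d%:~R = 0 :> 'Z_n.+2 -> (n.+2%:Z %| d)%Z.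
Proof.
have nat_case (l : nat) : l%:R = 0 :> 'Z_n.+2 -> (n.+2 %| l)%N.
  by move/(congr1 val); rewrite /= Zp_nat /= => /eqP.
case: d => l; first by rewrite dvdzE => /nat_case.
rewrite NegzE mulrNz => /eqP; rewrite oppr_eq0 => /eqP /nat_case.
by rewrite dvdzE abszN.
Qed.

(** * Reduction of exponents modulo an integer *)

Section Reduction.
Variables (k n : nat).
Notation Zk := 'rV[int]_k.
Notation T := 'rV['Z_n.+2]_k.

Definition red (z : Zk) : T := map_mx intr z.
Definition lift_red (t : T) : Zk := map_mx (fun a : 'Z_n.+2 => Posz a) t.

Lemma redD y z : red (y + z) = red y + red z.
Proof. by apply/rowP => j; rewrite !mxE intrD. Qed.

Lemma red_lift t : red (lift_red t) = t.
Proof. by apply/rowP => j; rewrite !mxE -[RHS]natr_Zp. Qed.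

Lemma red_eq y z : red y = red z -> exists w, y = z + n.+2%:Z *: w.
Proof.
move/rowP => e.
have d j : (n.+2%:Z %| y 0%R j - z 0%R j)%Z.
  by apply: intr_Zp_eq0; move: (e j); rewrite !mxE intrD mulrNz => ->; rewrite subrr.
exists (\row_j ((y 0%R j - z 0%R j) %/ n.+2%:Z)%Z).
by apply/rowP => j; rewrite !mxE mulrC divzK // addrC subrK.
Qed.

Lemma red_mul (A : 'M[int]_k) y z : red y = red z -> red (y *m A) = red (z *m A).
Proof.
case/red_eq => w ->; rewrite mulmxDl redD -scalemxAl -[RHS]addr0; congr (_ + _).
apply/rowP => j; rewrite !mxE intrM -pmulrn.
by rewrite (@pchar_Zp n.+2) // mul0r.
Qed.

End Reduction.

Lemma exists_finite_reduction k (A : 'M[int]_k) (d : seq 'rV[int]_k) :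
  exists (T : finType) (rho : 'rV[int]_k -> T) (sec : T -> 'rV[int]_k),
    [/\ cancel sec rho, {in d &, injective rho},
        forall x y z, rho y = rho z -> rho (y + x) = rho (z + x) &
        forall y z, rho y = rho z -> rho (y *m A) = rho (z *m A)].
Proof.
(* Entries of members of [d] differ by at most [N + N], which is less than the modulus
   [(N + N).+2]. *)
pose N := (\sum_(z <- d) \sum_j `|z 0%R j|)%N.
have bound (z : 'rV[int]_k) j : z \in d -> (`|z 0%R j| <= N)%N.
  move=> zd; rewrite /N (big_rem z) //= (bigD1 j) //= -addnA; exact: leq_addr.
exists 'rV['Z_(N + N).+2]_k, (@red k (N + N)), (@lift_red k (N + N)); split.
- exact: red_lift.
- move=> y z yd zd /rowP e; apply/rowP => j.
  have /intr_Zp_eq0 : (y 0 j - z 0 j)%:~R = 0 :> 'Z_(N + N).+2.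
    by move: (e j); rewrite !mxE intrD mulrNz => ->; rewrite subrr.
  move: (bound _ j yd) (bound _ j zd); move: (y 0 j) (z 0 j) => a b ba bb.
  rewrite dvdzE /= => dv; apply/eqP; rewrite -subr_eq0 -absz_eq0.
  case: posnP => // pos; have := dvdn_leq pos dv.
  by move: ba bb; lia.
- by move=> x y z e; rewrite !redD e.
- by move=> y z; apply: red_mul.
Qed.

(** * Push-forward of finitely supported functions to a finite quotient of [Z^k] *)

Section Periodize.
Variables (V : zmodType) (k : nat).
Notation Zk := 'rV[int]_k.
Notation Sig := {malg V[Zk]}.

Definition shift (x : Zk) : Sig -> Sig :=
  malg_ext (fun z => mkmalgU (x + z) : {additive V -> Sig}).
HB.instance Definition _ x := GRing.Additive.on (shift x).

Lemma shiftU x g z : shift x << g *g z >> = << g *g x + z >>.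
Proof. exact: malg_extU. Qed.

Lemma mcoeff_shift x (s : Sig) y : (shift x s)@_y = s@_(y - x).
Proof.
move: s; apply: (@additive_malgP _ _ _ (mcoeff y \o shift x) (mcoeff (y - x))).
by move=> g z /=; rewrite shiftU !mcoeffU addrC eq_sym -subr_eq eq_sym.
Qed.

Variables (T : finType) (rho : Zk -> T) (sec : T -> Zk).
Hypothesis secK : cancel sec rho.
Hypothesis rhoD : forall x y z, rho y = rho z -> rho (y + x) = rho (z + x).
Notation SigN := {ffun T -> V}.

Definition ffun_delta (t : T) (g : V) : SigN := [ffun u => g *+ (t == u)].
Fact ffun_delta_is_additive t : additive (ffun_delta t).
Proof. by move=> g h; apply/ffunP => u; rewrite !ffunE mulrnBl. Qed.
HB.instance Definition _ t := 
  GRing.isAdditive.Build V SigN (ffun_delta t) (ffun_delta_is_additive t).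

Definition periodize : Sig -> SigN :=
  malg_ext (fun z => ffun_delta (rho z) : {additive V -> SigN}).
HB.instance Definition _ := GRing.Additive.on periodize.

Lemma periodizeU g z : periodize << g *g z >> = ffun_delta (rho z) g.
Proof. exact: malg_extU. Qed.

(** An additive section of [periodize], supported on the chosen representatives; it need not commute
    with shifts. *)
Definition unperiodize (f : SigN) : Sig := \sum_t << f t *g sec t >>.
Fact unperiodize_is_additive : additive unperiodize.
Proof.
move=> f h; rewrite -sumrB; apply: eq_bigr => t _.
by rewrite !ffunE monalgUB.
Qed.
HB.instance Definition _ := 
  GRing.isAdditive.Build SigN Sig unperiodize unperiodize_is_additive.

Lemma unperiodizeK : cancel unperiodize periodize.
Proof.
move=> f; rewrite raddf_sum; apply/ffunP => u; rewrite sum_ffunE (bigD1 u) //=.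
rewrite periodizeU ffunE secK eqxx big1 ?addr0 // => t /negPf tu.
by rewrite periodizeU ffunE secK tu.
Qed.

Lemma unperiodize_delta t g : unperiodize (ffun_delta t g) = << g *g sec t >>.
Proof.
rewrite /unperiodize (bigD1 t) //= ffunE eqxx big1 ?addr0 // => u.
by rewrite eq_sym ffunE => /negPf ->; rewrite monalgU0.
Qed.

Lemma periodize_shift x y (s : Sig) :
  rho x = rho y -> periodize (shift x s) = periodize (shift y s).
Proof.
move=> e; move: s.
apply: (@additive_malgP _ _ _ (periodize \o shift x) (periodize \o shift y)).
by move=> g z /=; rewrite !shiftU !periodizeU (rhoD z e).
Qed.

Lemma periodize_coeff (d : {fset Zk}) (s : Sig) z :
  {in d &, injective rho} -> (msupp s `<=` d)%fset -> z \in d ->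
  periodize s (rho z) = s@_z.
Proof.
move=> inj sd zd; rewrite /periodize (malg_extEw _ sd) sum_ffunE.
rewrite (big_fsetD1 z) //= ffunE eqxx big_seq big1 ?addr0 // => y.
rewrite in_fsetD1 => /andP [yz yd]; rewrite ffunE.
by case: eqP => // /inj e; rewrite e ?eqxx // in yz.
Qed.

End Periodize.

Section FiniteQuotient.
Variables (S U : zmodType) (X : finType) (toU : X -> U) (ofU : U -> X).
Hypotheses (toUK : cancel toU ofU) (ofUK : cancel ofU toU).
Variables (phi : {additive S -> S}) (pi : {additive S -> U}) (sec : {additive U -> S}).
Hypotheses (secK : cancel sec pi).
Hypothesis pi_phi : forall s, pi (phi (sec (pi s))) = pi (phi s).

(* [1 - phi] induces an endomorphism [theta] of the finite group [U], for which
   the kernel has as many elements as the cokernel. *)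
Lemma fixed_points_of_coker n :
  (forall t : 'I_n -> S, exists i j w, i <> j /\ t i - t j = w - phi w) ->
  forall f : 'I_n -> S, (forall i, phi (f i) = f i) ->
  exists i j, i <> j /\ pi (f i) = pi (f j).
Proof.
move=> cok f fix_f; apply: NNPP => no.
have f_inj i j : pi (f i) = pi (f j) -> i = j.
  by move=> e; apply: NNPP => ij; apply: no; exists i, j.
pose theta t := t - pi (phi (sec t)).
have theta_add : additive theta.
  by move=> s t; rewrite /theta !(raddfB sec, raddfB phi, raddfB pi) opprD addrACA -opprD.
pose thetaA : {additive U -> U} := HB.pack theta (GRing.isAdditive.Build _ _ theta theta_add).
(* Fixed points of [phi] project into the kernel of [theta], and here they stay distinct. *)
have ker_big : (n <= #|[set x | thetaA (toU x) == 0%R]|)%N.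
  have inj_pf : injective (fun i => ofU (pi (f i))).
    by move=> i j /= /(can_inj ofUK); apply: f_inj.
  rewrite -[leqLHS]card_ord -(card_codom inj_pf).
  apply/subset_leq_card/subsetP => _ /codomP [i ->].
  by rewrite inE /= ofUK /theta pi_phi fix_f subrr.
have [r rP] := incongruent_mod_im toUK ofUK ker_big.
have [i [j [w [ij e]]]] := cok (fun i => sec (r i)).
apply: ij; apply: (rP i j (pi w)).
by move/(congr1 pi): e; rewrite !raddfB !secK => ->; rewrite /= /theta pi_phi.
Qed.

End FiniteQuotient.

Section FixedPoints.
Variables (V : zmodType) (k : nat) (A : 'M[int]_k).
Notation Zk := 'rV[int]_k.
Notation Sig := {malg V[Zk]}.
Variable phi : {additive Sig -> Sig}.
Variables (X : finType) (toV : X -> V) (ofV : V -> X).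
Hypotheses (toVK : cancel toV ofV) (ofVK : cancel ofV toV).
Hypothesis phiU : forall g z, phi << g *g z >> = shift (z *m A) (phi << g *g 0 >>).

(** The exponents are reduced by a map [rho] that is injective on the union [d] of the supports, so
    distinct [f i] remain distinct. By semilinearity [phi] descends to the finite quotient, where
    kernel and cokernel have equal size. *)
Lemma finite_fixed_points n :
  (forall t : 'I_n -> Sig, exists i j w, i <> j /\ t i - t j = w - phi w) ->
  forall f : 'I_n -> Sig, (forall i, phi (f i) = f i) ->
  exists i j, i <> j /\ f i = f j.
Proof.
move=> cok f fix_f.
pose d := (\bigcup_(i <- enum 'I_n) msupp (f i))%fset.
have [T [rho [sec [secK inj rhoD rhoA]]]] := exists_finite_reduction A d.
pose toU (x : {ffun T -> X}) : {ffun T -> V} := [ffun t => toV (x t)].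
pose ofU (y : {ffun T -> V}) : {ffun T -> X} := [ffun t => ofV (y t)].
have toUK : cancel toU ofU by move=> x; apply/ffunP => t; rewrite !ffunE toVK.
have ofUK : cancel ofU toU by move=> x; apply/ffunP => t; rewrite !ffunE ofVK.
have pi_phi s : periodize rho (phi (unperiodize sec (periodize rho s)))
              = periodize rho (phi s).
  move: s; apply: (@additive_malgP _ _ _
    (periodize rho \o phi \o unperiodize sec \o periodize rho) (periodize rho \o phi)).
  move=> g z /=; rewrite periodizeU unperiodize_delta.
  rewrite phiU [in RHS]phiU; apply: periodize_shift => //; apply: rhoA.
  by rewrite secK.
have [i [j [ij e]]] := fixed_points_of_coker toUK ofUK (unperiodizeK secK) pi_phi cok fix_f.
exists i, j; split=> //; apply/malgP => z.
have sub i' : (msupp (f i') `<=` d)%fset by apply: bigfcup_sup; rewrite // mem_enum.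
have [zd|zd] := boolP (z \in d).
  by rewrite -(periodize_coeff inj (sub i) zd) e (periodize_coeff inj (sub j)).
rewrite !mcoeff_outdom //; apply: contra zd; exact/fsubsetP.
Qed.

End FixedPoints.

(** * Units of group rings of [Z^k] *)

Lemma exists_separating_linear_form k (d : seq 'rV[int]_k) :
  exists h : {additive 'rV[int]_k -> int}, {in d &, injective h}.
Proof.
(* [h z] is the value at [M] of the polynomial with coefficients [z]. *)
pose P := \prod_(yz <- [seq (y, z) | y <- d, z <- d] | yz.1 != yz.2)
  rVpoly (yz.1 - yz.2).
have P0 : P != 0.
  rewrite prodf_seq_neq0; apply/allP => -[y z] _ /=; apply/implyP => yz.
  apply: contraNneq yz => e.
  by rewrite -subr_eq0 -(rVpolyK (y - z)) e linear0.
(* A nonzero polynomial cannot have the [size P] distinct roots [0], ..., [size P - 1]. *)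
have [M Mroot] : exists M : int, ~~ root P M.
  apply: NNPP => no.
  pose rs := [seq Posz i | i <- iota 0 (size P)].
  have rsP : all (root P) rs.
    by apply/allP => M _; apply: contraT => h; case: no; exists M.
  have rsU : uniq rs by rewrite map_inj_uniq ?iota_uniq // => i j [].
  by have := max_poly_roots P0 rsP rsU; rewrite size_map size_iota ltnn.
pose h (z : 'rV[int]_k) := (rVpoly z).[M].
have h_add : additive h by move=> y z; rewrite /h linearB /= hornerD hornerN.
pose hA : {additive _ -> _} := HB.pack h (GRing.isAdditive.Build _ _ h h_add).
exists hA => y z yd zd /= e.
apply/eqP; apply: contraNT Mroot => yz.
have yz_in : (y, z) \in [seq (y, z) | y <- d, z <- d] by apply: allpairs_f.
rewrite /P (big_rem _ yz_in) /= yz rootM; apply/orP; left.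
by rewrite /root -/(h (y - z)) h_add e subrr.
Qed.

Lemma seq_max (X : eqType) (h : X -> int) (s : seq X) : s != [::] ->
  exists2 x, x \in s & {in s, forall y, h y <= h x}.
Proof.
elim: s => // x s IH _; have [->|/IH [y ys ymax]] := eqVneq s [::].
  by exists x; rewrite ?mem_head // => y; rewrite inE => /eqP ->.
have [le|lt] := lerP (h x) (h y); [exists y | exists x]; rewrite ?inE ?ys ?eqxx ?orbT //.
  by move=> z; rewrite inE => /predU1P [->|/ymax].
move=> z; rewrite inE => /predU1P [->//|/ymax le].
exact: le_trans le (ltW lt).
Qed.

Section TrivialUnits.
Variables (k : nat) (F : idomainType) (W : seq 'rV[int]_k).
Variables (f : 'rV[int]_k -> 'rV[int]_k) (u v : 'rV[int]_k -> F).
Hypotheses (f_inj : injective f) (W_uniq : uniq W).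
Hypothesis uv : forall y, \sum_(z <- W) v z * u (y - f z) = (y == 0)%:R.

(* The product of the [h]-leading terms of [u] and [v] is alone in its degree. *)
Lemma leading_terms_cancel (U : seq 'rV[int]_k) (h : {additive 'rV[int]_k -> int}) :
  (forall y, u y != 0 -> y \in U) ->
  {in U &, injective h} -> {in [seq f z | z <- W] &, injective h} ->
  exists y z, [/\ u y != 0, z \in W & v z != 0] /\
   [/\ y + f z = 0, forall y', u y' != 0 -> h y' <= h y &
    forall z', z' \in W -> v z' != 0 -> h (f z') <= h (f z)].
Proof.
move=> suppU injU injW.
have : exists2 z, z \in W & v z * u (0 - f z) != 0.
  apply: NNPP => no; move: (uv 0); rewrite eqxx big_seq big1 => [/esym/eqP|z zW].
    by rewrite oner_eq0.
  by apply/eqP; apply: contraT => h0; case: no; exists z.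
case=> z0 z0W; rewrite mulf_eq0 negb_or => /andP [vz0 uz0].
have [|y] := @seq_max _ h [seq y <- U | u y != 0].
  by rewrite -has_filter; apply/hasP; exists (0 - f z0); rewrite // suppU.
rewrite mem_filter => /andP [uy yU] ymax.
have [|z] := @seq_max _ (h \o f) [seq z <- W | v z != 0].
  by rewrite -has_filter; apply/hasP; exists z0.
rewrite mem_filter => /andP [vz zW] zmax; exists y, z; split; split=> //.
- apply/eqP; move: (uv (y + f z)); rewrite (big_rem z) //= addrK big_seq big1.
    rewrite addr0; case: eqP => // _ /eqP.
    by rewrite mulf_eq0 (negPf uy) (negPf vz).
  move=> z'; rewrite (mem_rem_uniq _ W_uniq) inE => /andP [z'z z'W].
  apply/eqP; rewrite mulf_eq0; apply: contraNT z'z; rewrite negb_or => /andP [vz' uy'].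
  have l1 := ymax (y + f z - f z'); rewrite mem_filter uy' suppU // in l1.
  have l2 := zmax z'; rewrite mem_filter vz' z'W /= in l2.
  move: (l1 isT) (l2 isT); rewrite raddfB raddfD => {}l1 {}l2.
  apply/eqP/f_inj/injW; rewrite ?map_f //; apply/eqP.
  by rewrite eq_le l2 -(lerD2l (h y)) -lerBlDr.
- by move=> y' uy'; apply: ymax; rewrite mem_filter uy' suppU.
by move=> z' z'W vz'; apply: zmax; rewrite mem_filter vz' z'W.
Qed.

(** The hypothesis [uv] makes [u] a unit of the group ring, with inverse the sum of the [v z] placed
    at [f z]. Its leading terms for [h] and for [- h] both cancel against terms of the inverse,
    which forces the maximum and the minimum of [h] on the support of [u] to agree. *)
Lemma trivial_unit (U : seq 'rV[int]_k) : (forall y, u y != 0 -> y \in U) ->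
  exists m, u m != 0 /\ forall y, y != m -> u y = 0.
Proof.
move=> suppU.
have [h hinj] := exists_separating_linear_form (U ++ [seq f z | z <- W]).
have injU : {in U &, injective h}.
  by move=> y z yU zU; apply: hinj; rewrite mem_cat ?yU ?zU.
have injW : {in [seq f z | z <- W] &, injective h}.
  by move=> y z yU zU; apply: hinj; rewrite mem_cat ?yU ?zU orbT.
pose nh z := - h z.
have nh_add : additive nh by move=> y z; rewrite /nh raddfB opprB opprK addrC.
pose nhA : {additive _ -> _} := HB.pack nh (GRing.isAdditive.Build _ _ nh nh_add).
have [y [z [[uy zW vz] [yz ymax zmax]]]] := leading_terms_cancel suppU injU injW.
have [||y' [z' [[uy' z'W vz'] [yz' ymax' zmax']]]] :=
    @leading_terms_cancel U nhA suppU.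
- by move=> a b aU bU /oppr_inj; apply: injU.
- by move=> a b aU bU /oppr_inj; apply: injW.
exists y; split=> // x xy; apply/eqP; apply: contraNT xy => ux.
apply/eqP/injU; rewrite ?suppU //.
move: (congr1 h yz) (congr1 h yz'); rewrite !raddfD raddf0 /= => e e'.
move: (ymax _ ux) (ymax' _ ux) (zmax _ z'W vz'); rewrite /= /nh.
by move: e e'; lia.
Qed.

End TrivialUnits.

(** * The action on the rank one subquotient *)

(** If [iter a B z = iter b B x], the value at [z] is [c ^+ (a + b)], which equals [c] to the power
    [b - a] as [c * c = 1]; elsewhere it is [0]. Iterates are taken on both sides because [B] is not
    assumed invertible. *)
Lemma orbit_character (X : Type) (R : pzRingType) (B : X -> X) (c : R) (x : X) :
  c * c = 1 -> (forall a b, iter a B x = iter b B x -> c ^+ a = c ^+ b) ->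
  exists chi : X -> R,
    [/\ chi x = 1, forall z, chi (B z) = c * chi z &
        forall z, (forall a b, iter a B z <> iter b B x) -> chi z = 0].
Proof.
move=> cc good.
pose P z v := (exists a b, iter a B z = iter b B x /\ v = c ^+ (a + b)) \/
  ((forall a b, iter a B z <> iter b B x) /\ v = 0).
have [chi chiP] : exists chi, forall z, P z (chi z).
  apply: functional_choice => z.
  have [[a [b e]]|no] := classic (exists a b, iter a B z = iter b B x).
    by exists (c ^+ (a + b)); left; exists a, b.
  by exists 0; right; split=> // a b e; apply: no; exists a, b.
have chiE z a b : iter a B z = iter b B x -> chi z = c ^+ (a + b).
  move=> e; case: (chiP z) => [[a' [b' [e' ->]]]|[/(_ a b)//]].
  (* Two descriptions of [z] give [iter (a' + b) B x = iter (a + b') B x]; the rest is parity of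
     exponents. *)
  have := good (a' + b)%N (a + b')%N; rewrite !iterD -e -e' -!iterD addnC.
  move=> /(_ erefl) e''.
  have parity n l : odd n = odd l -> c ^+ n = c ^+ l.
    by move=> nl; rewrite (expr_sq1 n cc) nl -expr_sq1.
  rewrite (parity (a' + b') (a + b' + (a + a')))%N; last by lia.
  by rewrite exprD -e'' -exprD; apply: parity; lia.
exists chi; split=> [|z|z no].
- by rewrite (chiE _ 0 0).
- case: (chiP z) => [[a [b [e ->]]]|[no ->]].
    by rewrite (chiE (B z) a b.+1) ?addnS ?exprS // -iterSr !iterS e.
  rewrite mulr0; case: (chiP (B z)) => [[a [b [e _]]]|[_ //]].
  by case: (no a.+1 b); rewrite iterSr.
by case: (chiP z) => [[a [b [/no]]]|[]].
Qed.

Section SemilinearAutomorphism.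
Variables (V : zmodType) (F : fieldType) (k : nat) (A A' : 'M[int]_k).
Notation Zk := 'rV[int]_k.
Notation Sig := {malg V[Zk]}.
Hypotheses (k_gt0 : (0 < k)%N) (AA' : A *m A' = 1%:M).
Hypothesis detA : \det (1%:M - A) != 0.
Variables (phi : {additive Sig -> Sig}) (psi : Sig -> Sig).
Hypotheses (phi_inj : injective phi) (psiK : cancel psi phi).
Hypothesis phiU : forall g z, phi << g *g z >> = shift (z *m A) (phi << g *g 0 >>).
Variables (p r : nat) (lam : {additive V -> F}) (a : V).
Hypotheses (p0 : p%:R = 0 :> F) (F_nat : forall x : F, exists n, x = n%:R).
Hypotheses (lam_a : lam a = 1) (a_tors : a *+ p ^ r = 0).
Hypothesis lam_low : forall g, g *+ p ^ r.-1 = 0 -> lam g = 0.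
Hypothesis lam_ker : forall g, g *+ p ^ r = 0 -> lam g = 0 ->
  exists c d, g = c + d *+ p /\ c *+ p ^ r.-1 = 0.

Lemma lam_coeff_split (s t : Sig) y : s *+ p ^ r.-1 = 0 -> lam (s + t *+ p)@_y = 0.
Proof.
move=> sr; rewrite mcoeffD mcoeffMn (raddfD lam) (raddfMn lam).
by rewrite lam_low -?mcoeffMn ?sr ?mcoeff0 // -mulr_natr p0 mulr0 addr0.
Qed.

Lemma lam_phi_ker g z y : g *+ p ^ r = 0 -> lam g = 0 ->
  lam (phi << g *g z >>)@_y = 0.
Proof.
move=> gr /(lam_ker gr) [c [d [-> cr]]].
rewrite monalgUD monalgUMn (raddfD phi) (raddfMn phi); apply: lam_coeff_split.
by rewrite -(raddfMn phi) -monalgUMn cr monalgU0 raddf0.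
Qed.

(** Write [lam g = n%:R]. Then [g] and [a *+ n] differ by a torsion element of the kernel of [lam],
    which [lam_phi_ker] discards. *)
Lemma lam_phiE g z y : g *+ p ^ r = 0 ->
  lam (phi << g *g z >>)@_y = lam g * lam (phi << a *g 0 >>)@_(y - z *m A).
Proof.
move=> gr; rewrite -mcoeff_shift -phiU.
have [n en] := F_nat (lam g).
have lamB (s t : Sig) : lam (s - t *+ n)@_y = 0 -> lam s@_y = n%:R * lam t@_y.
  rewrite mcoeffB mcoeffMn (raddfB lam) (raddfMn lam) mulr_natl => /eqP.
  by rewrite subr_eq0 => /eqP.
rewrite en; apply: lamB; rewrite -(raddfMn phi) -(raddfB phi) -monalgUMn -monalgUB.
apply: lam_phi_ker; first by rewrite mulrnBl gr mulrnAC a_tors mul0rn subr0.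
by rewrite (raddfB lam) (raddfMn lam) lam_a -en subrr.
Qed.

Lemma lam_phi_sum (s : Sig) y :
  lam (phi s)@_y = \sum_(z <- msupp s) lam (phi << s@_z *g z >>)@_y.
Proof.
rewrite {1}(monalgE s) (raddf_sum phi) (raddf_sum (mcoeff y)).
by rewrite (raddf_sum lam).
Qed.

(** On the rank one quotient [phi] is given by the element [u] of the group ring over [F]. A
    preimage of [<< a *g 0 >>] supplies an inverse of [u], so [u] is a monomial by
    [trivial_unit]. *)
Lemma lam_phi_monomial : exists m, exists2 c, c != 0 &
  forall g z y, g *+ p ^ r = 0 ->
    lam (phi << g *g z >>)@_y = c * lam g *+ (y == z *m A + m).
Proof.
pose u y := lam (phi << a *g 0 >>)@_y.
pose s := psi << a *g 0 >>.
have s_tors z : s@_z *+ p ^ r = 0.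
  rewrite -mcoeffMn; suff -> : s *+ p ^ r = 0 by rewrite mcoeff0.
  by apply: phi_inj; rewrite raddf0 (raddfMn phi) psiK -monalgUMn a_tors monalgU0.
have A_inj : injective (fun z : Zk => z *m A).
  by move=> y z e; rewrite -[y]mulmx1 -[z]mulmx1 -AA' !mulmxA e.
have uv y : \sum_(z <- msupp s) lam s@_z * u (y - z *m A) = (y == 0)%:R.
  transitivity (lam (phi s)@_y); last first.
    by rewrite psiK mcoeffU (raddfMn lam) lam_a eq_sym.
  rewrite lam_phi_sum; apply: eq_bigr => z _.
  by rewrite lam_phiE.
have [|m [um uP]] := trivial_unit A_inj (fset_uniq _) uv (U := msupp (phi << a *g 0 >>)).
  move=> y; rewrite -mcoeff_neq0; apply: contra => /eqP e.
  by rewrite /u e (raddf0 lam).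
exists m, (u m) => // g z y gr; rewrite lam_phiE // -/(u _).
have [->|ne] := eqVneq y (z *m A + m).
  by rewrite addrC addKr mulrC mulr1n.
by rewrite uP ?mulr0 // subr_eq addrC.
Qed.

Variable n : nat.
Hypothesis cok : forall t : 'I_n -> Sig,
  exists i j w, i <> j /\ t i - t j = w - phi w.
Hypothesis fixed_points : forall f : 'I_n -> Sig, (forall i, phi (f i) = f i) ->
  exists i j, i <> j /\ f i = f j.

(* Multiplication by [p^r] sends [w] with [w - phi w] torsion to a fixed point
   of [phi]; among enough such [w], two therefore differ by a torsion element. *)
Lemma torsion_coker_relation (t : nat -> Sig) : (forall i, t i *+ p ^ r = 0) ->
  exists i j i' j' w, [/\ [/\ i <> j, i <> i' & i <> j'], w *+ p ^ r = 0 &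
    t i - t j - (t i' - t j') = w - phi w].
Proof.
move=> t_tors.
(* The indices are cut into blocks of length [n], each of which contains a relation; distinct blocks
   keep the indices of two relations apart. *)
pose R b (z : 'I_n * 'I_n * Sig) := z.1.1 <> z.1.2 /\
    t (b * n + z.1.1)%N - t (b * n + z.1.2)%N = z.2 - phi z.2.
have R_ex b : exists z, R b z.
  have [i [j [w [ij e]]]] := cok (fun i : 'I_n => t (b * n + i)%N).
  by exists (i, j, w).
have [q qP] := functional_choice R R_ex.
have [b [b' [bb' e]]] : exists b b' : 'I_n, b <> b' /\ (q b).2 *+ p ^ r = (q b').2 *+ p ^ r.
  apply: fixed_points => b.
  apply/esym/eqP; rewrite -subr_eq0 (raddfMn phi) -mulrnBl; have [_ <-] := qP b.
  by rewrite mulrnBl !t_tors subrr.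
have disj (i j : 'I_n) : (b * n + i <> b' * n + j)%N.
  move=> /(congr1 (fun z => z %/ n)%N).
  have n_gt0 : (0 < n)%N by apply: leq_ltn_trans (ltn_ord b).
  by rewrite !divnMDl // !divn_small // !addn0 => /val_inj.
exists (b * n + (q b).1.1)%N, (b * n + (q b).1.2)%N.
exists (b' * n + (q b').1.1)%N, (b' * n + (q b').1.2)%N, ((q b).2 - (q b').2).
have [ij eb] := qP b; have [_ eb'] := qP b'; split.
- by split=> // /addnI /val_inj.
- by rewrite mulrnBl e subrr.
by rewrite eb eb' (raddfB phi) [X in _ + X = _]opprD addrACA -opprD.
Qed.

(** The functional [L], weighting [lam] by the orbit character of [x i], is [phi]-invariant on
    [p ^ r]-torsion. It therefore kills [w - phi w], yet takes the value [1] on the other side of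
    the relation, where only [t i] lies on that orbit. *)
Lemma coker_not_finite : (p == 2)%N || (p == 3)%N && odd k -> False.
Proof.
move=> hp.
have [m [c c0 lamU]] := lam_phi_monomial.
have [cc hc] : c * c = 1 /\ (c = 1 \/ odd k).
  (* A nonzero element of the prime field is [1] for [p = 2], and is [1] or [2] for [p = 3], where
     [2 * 2 = 1]. *)
  have [l ec] := F_nat c; rewrite {}ec in c0 *.
  case/orP: hp => [/eqP p2|/andP [/eqP p3 ok]].
    have q0 : 2%:R = 0 :> F by rewrite -p2.
    have {c0} -> : l%:R = 1 :> F.
      move: c0; rewrite -(odd_double_half l) natrD -mul2n natrM q0 mul0r addr0.
      by case: (odd l); rewrite ?eqxx.
    by rewrite mulr1; split=> //; left.
  split; last by right.
  have q0 : 3%:R = 0 :> F by rewrite -p3.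
  move: c0; rewrite (divn_eq l 3) natrD natrM q0 mulr0 add0r.
  have : (l %% 3 < 3)%N by rewrite ltn_mod.
  case: (l %% 3)%N => [|[|[|//]]] _; rewrite ?eqxx ?mulr1 // => _.
  by apply/eqP; rewrite -subr_eq0 -natrM -(natrB _ (isT : 1 <= 4)%N) q0.
have [x [xgood xdiff]] := infinitely_many_orbits m AA' detA k_gt0 cc hc.
pose t i : Sig := << a *g x i >>.
have [i [j [i' [j' [w [[ij ii' ij'] w_tors e]]]]]] : exists i j i' j' w,
    [/\ [/\ i <> j, i <> i' & i <> j'], w *+ p ^ r = 0 &
      t i - t j - (t i' - t j') = w - phi w].
  by apply: torsion_coker_relation => i; rewrite -monalgUMn a_tors monalgU0.
have [chi [chi_i chiB chi0]] := orbit_character cc (xgood i).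
pose f z g := chi z * lam g.
have f_add z : additive (f z) by move=> g h; rewrite /f (raddfB lam) mulrBr.
pose fA z : {additive _ -> _} := HB.pack (f z) (GRing.isAdditive.Build _ _ (f z) (f_add z)).
pose L : {additive Sig -> F} := malg_ext fA.
have LU g z : L << g *g z >> = chi z * lam g by apply: (malg_extU fA).
have L_phi (s : Sig) : s *+ p ^ r = 0 -> L (phi s) = L s.
  move=> s_tors; rewrite {1}(monalgE s) (raddf_sum phi) (raddf_sum L).
  transitivity (\sum_(z <- msupp s) L << s@_z *g z >>); last first.
    by rewrite -(raddf_sum L) -monalgE.
  apply: eq_bigr => z _; rewrite LU.
  have gr : s@_z *+ p ^ r = 0 by rewrite -mcoeffMn s_tors mcoeff0.
  move: (s@_z) gr => g gr; pose s' := phi << g *g z >>.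
  pose d := (affine A m z |` msupp s')%fset.
  have -> : L (phi << g *g z >>) = malg_ext fA (phi << g *g z >>) by [].
  rewrite (@malg_extEw _ _ _ _ _ d) ?fsubsetU1 // (big_fsetD1 (affine A m z)) ?fset1U1 //=.
  rewrite /f lamU // /affine eqxx mulr1n big_seq big1 ?addr0.
    by rewrite -/(affine A m z) chiB mulrACA cc mul1r.
  by move=> y; rewrite in_fsetD1 => /andP [/negPf yz _]; rewrite lamU // yz mulr0.
have chi_other l : i <> l -> chi (x l) = 0.
  move=> il; apply: chi0 => b b' e'; apply: il.
  by rewrite (xdiff _ _ _ _ e').
have LB (s1 s2 s3 s4 : Sig) : L (s1 - s2 - (s3 - s4)) = L s1 - L s2 - (L s3 - L s4).
  by rewrite !(raddfB L).
have Lt l : L (t l) = chi (x l) by rewrite /t LU lam_a mulr1.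
have Lw : L (w - phi w) = 0 by rewrite (raddfB L) L_phi // subrr.
have := etrans (esym (LB _ _ _ _)) (etrans (congr1 L e) Lw).
rewrite (Lt i) (Lt j) (Lt i') (Lt j') chi_i !chi_other // !subr0 => /eqP.
by rewrite oner_eq0.
Qed.

End SemilinearAutomorphism.

(** * Automorphisms of the wreath product *)

(** The proof of commutativity is a parameter of the type, so that an additive group structure can
    be attached to it. *)
Definition additive_subg (gT : finGroupType) (G : {group gT}) of abelian G : Type :=
  subg_of G.

Section AdditiveSubg.
Variables (gT : finGroupType) (G : {group gT}) (abG : abelian G).
Notation V := (additive_subg abG).

HB.instance Definition _ := Choice.copy V (subg_of G).

Let addV (x y : V) : V := ((x : subg_of G) * y)%g.
Let oppV (x : V) : V := ((x : subg_of G)^-1)%g.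
Let zeroV : V := (1%g : subg_of G).

Fact addVA : associative addV. Proof. by move=> x y z; apply: mulgA. Qed.
Fact addVC : commutative addV.
Proof. by move=> x y; apply/val_inj/(centsP abG); apply: valP. Qed.
Fact add0V : left_id zeroV addV. Proof. by move=> x; apply: mul1g. Qed.
Fact addNV : left_inverse zeroV oppV addV. Proof. by move=> x; apply: mulVg. Qed.
HB.instance Definition _ := GRing.isZmodule.Build V addVA addVC add0V addNV.

Definition abval (x : V) : gT := sgval x.

Lemma abval_inj : injective abval. Proof. exact: val_inj. Qed.
Lemma abval_mem x : abval x \in G. Proof. exact: valP. Qed.
Lemma abvalD x y : abval (x + y) = (abval x * abval y)%g. Proof. by []. Qed.
Lemma abvalMn x n : abval (x *+ n) = (abval x ^+ n)%g.
Proof. by elim: n => // n IH; rewrite mulrS abvalD IH expgS. Qed.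
Lemma abval_surj g : g \in G -> exists x, abval x = g.
Proof. by move=> gG; exists (subg G g); rewrite /abval subgK. Qed.

End AdditiveSubg.

Lemma addr_sub_cancel (U : zmodType) (a b c a' b' c' : U) :
  a + b - c = a' + b' - c' -> b - b' = (c - c') - (a - a').
Proof.
move=> e; have -> : b = a' + b' - c' + c - a by rewrite -e subrK addrAC subrr add0r.
rewrite [a' + b']addrC -!addrA addrC -!addrA addNr addr0 opprB.
by rewrite [- c' + (c - a)]addrCA [LHS]addrCA; congr (_ + _); rewrite addrCA.
Qed.

(** Positions in [L] are compared instead of elements, as equality on [X] need not be decidable. *)
Lemma list_pigeonhole (X : Type) (L : list X) (Q : nat -> X -> Prop) :
  (forall i, exists y, List.In y L /\ Q i y) ->
  exists (i j : 'I_(length L).+1) y, [/\ i <> j, Q i y & Q j y].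
Proof.
move=> h.
have ex n : exists l : 'I_(length L), exists y, List.nth_error L l = Some y /\ Q n y.
  have [y [yL qy]] := h n; have [l e] := List.In_nth_error _ _ yL.
  have ll : (l < length L)%N.
    by apply/ssrnat.ltP; apply: (proj1 (List.nth_error_Some L l)); rewrite e.
  by exists (Ordinal ll), y.
have [f fP] := functional_choice _ ex.
have /injectivePn [i [j ij e]] : ~~ injectiveb (fun i : 'I_(length L).+1 => f i).
  by apply/negP => /injectiveP /leq_card; rewrite !card_ord ltnn.
have [y [ey qy]] := fP i; have [z [ez qz]] := fP j.
exists i, j, y; split=> //; first exact/eqP.
by move: ez; rewrite -e ey => -[->].
Qed.

(** * From automorphisms of the wreath product to semilinear maps of its base *)

Section Transport.
Variables (gT : finGroupType) (G : {group gT}) (abG : abelian G) (k : nat).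
Notation V := (additive_subg abG).
Notation Sig := {malg V['rV[int]_k]}.

Lemma shift0 (s : Sig) : shift 0 s = s.
Proof. by apply/malgP => z; rewrite mcoeff_shift subr0. Qed.

Lemma shift_shift x y (s : Sig) : shift x (shift y s) = shift (x + y) s.
Proof. by apply/malgP => z; rewrite !mcoeff_shift opprD addrA. Qed.

Definition wr_elt (s : Sig) (x : 'rV[int]_k) : wcarrier gT k :=
  (fun z => abval s@_z, x).

Lemma wr_elt_inj s t x y : wr_elt s x = wr_elt t y -> s = t /\ x = y.
Proof.
case=> e ->; split=> //; apply/malgP => z; apply: abval_inj.
exact: (congr1 (fun f => f z) e).
Qed.

Lemma wr_eltM s t x y :
  wmul (wr_elt s x) (wr_elt t y) = wr_elt (s + shift x t) (x + y).
Proof.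
congr pair; apply: functional_extensionality => z /=.
by rewrite mcoeffD mcoeff_shift.
Qed.

Lemma wr_eltV s x : winv (wr_elt s x) = wr_elt (- shift (- x) s) (- x).
Proof.
congr pair; apply: functional_extensionality => z /=.
by rewrite mcoeffN mcoeff_shift opprK.
Qed.

Lemma wr_elt_mem s x : wr_mem G (wr_elt s x).
Proof.
split=> [z|]; first exact: abval_mem.
exists (msupp s) => z /= nz; rewrite -mcoeff_neq0.
by apply: contraNneq nz => ->.
Qed.

Lemma wr_elt_surj w : wr_mem G w -> exists s, w = wr_elt s w.2.
Proof.
case: w => f x [/= fG [l lP]].
have [F FP] := functional_choice _ (fun z => abval_surj abG (fG z)).
exists [malg z in [fset z in l]%fset => F z].
congr pair; apply: functional_extensionality => z.
rewrite mcoeffE in_fset /=; case: ifPn => [_|zl]; first by rewrite FP.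
by apply/eqP; apply: contraNT zl; apply: lP.
Qed.

Variable phi : wcarrier gT k -> wcarrier gT k.
Hypothesis phi_aut : wr_aut G phi.

Let phi_mem w : wr_mem G w -> wr_mem G (phi w).
Proof. by have [h _ _ _] := phi_aut; apply: h. Qed.

Let phiM s t x y :
  phi (wmul (wr_elt s x) (wr_elt t y)) = wmul (phi (wr_elt s x)) (phi (wr_elt t y)).
Proof. by have [_ _ _ h] := phi_aut; apply: h; apply: wr_elt_mem. Qed.

Let tr s x := (phi (wr_elt s x)).2.

Let trM s t x y : tr (s + shift x t) (x + y) = tr s x + tr t y.
Proof. by rewrite /tr -wr_eltM phiM. Qed.

(** The base has exponent dividing [#|G|], while [Z^k] is torsion-free. *)
Lemma tr_torsion s : tr s 0 = 0.
Proof.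
have trMn n : tr (s *+ n) 0 = tr s 0 *+ n.
  elim: n => [|n IH].
    by apply: (addrI (tr (s *+ 0) 0)); rewrite -trM shift0 !addr0.
  by rewrite !mulrS -IH -trM shift0 addr0.
have s0 : s *+ #|G| = 0.
  apply/malgP => z; rewrite mcoeffMn mcoeff0; apply: abval_inj.
  by rewrite abvalMn expg_cardG ?abval_mem.
have : tr s 0 *+ #|G| = tr s 0 *+ 0 by rewrite -!trMn s0.
rewrite mulr0n => /rowP e; apply/rowP => j; move/eqP: (e j).
by rewrite mulmxnE !mxE mulrn_eq0 -leqn0 leqNgt cardG_gt0 => /eqP.
Qed.

Lemma exists_translation_matrix : exists A, forall s x, tr s x = x *m A.
Proof.
have trE s x : tr s x = tr 0 x.
  by rewrite -[RHS]add0r -(tr_torsion s) -trM raddf0 addr0 add0r.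
have tr_add : additive (tr 0).
  move=> x y; apply: (addIr (tr 0 y)); rewrite subrK -trM raddf0 addr0 subrK //.
pose trA : {additive _ -> _} := HB.pack (tr 0) (GRing.isAdditive.Build _ _ (tr 0) tr_add).
exists (\matrix_i trA (delta_mx 0 i)) => s x.
rewrite trE -[LHS]/(trA x) {1}(row_sum_delta x) raddf_sum mulmx_sum_row.
apply: eq_bigr => i _; rewrite rowK.
by rewrite -(intz (x 0 i)) !scaler_int raddfMz.
Qed.

Variable A : 'M[int]_k.
Hypothesis trA : forall s x, tr s x = x *m A.

Lemma exists_inverse_matrix : exists A', A *m A' = 1%:M.
Proof.
have ex (i : 'I_k) : exists y : 'rV[int]_k, y *m A = delta_mx 0 i.
  have [_ _ onto _] := phi_aut.
  have [v [vG e]] := onto _ (wr_elt_mem 0 (delta_mx 0 i)).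
  have [s ev] := wr_elt_surj vG; exists v.2.
  by rewrite -(trA s) /tr -ev e.
have [f fP] := functional_choice _ ex.
exists (\matrix_i f i); apply: mulmx1C; apply/row_matrixP => i.
by rewrite row_mul rowK fP row1.
Qed.

Lemma exists_base_aut : exists f : {additive Sig -> Sig},
  forall s, phi (wr_elt s 0) = wr_elt (f s) 0.
Proof.
have ex s : exists t, phi (wr_elt s 0) = wr_elt t 0.
  have [t e] := wr_elt_surj (phi_mem (wr_elt_mem s 0)); exists t.
  by rewrite {1}e -/(tr s 0) tr_torsion.
have [f fP] := functional_choice _ ex.
have fD s t : f (s + t) = f s + f t.
  have := phiM s t 0 0; rewrite !fP !wr_eltM addr0 fP !shift0.
  by case/wr_elt_inj.
have f_add : additive f.
  by move=> s t; apply: (addIr (f t)); rewrite -fD !subrK.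
pose fA : {additive _ -> _} := HB.pack f (GRing.isAdditive.Build _ _ f f_add).
by exists fA.
Qed.

Variable f : {additive Sig -> Sig}.
Hypothesis fE : forall s, phi (wr_elt s 0) = wr_elt (f s) 0.

Lemma base_aut_inj : injective f.
Proof.
move=> s t e; have [_ inj _ _] := phi_aut.
by have [|] := @wr_elt_inj s t 0 0 => //; apply: inj; rewrite ?fE ?e //; apply: wr_elt_mem.
Qed.

Lemma base_aut_surj A' : A *m A' = 1%:M -> exists g, cancel g f.
Proof.
move=> AA'; suff ex s : exists t, f t = s by apply: functional_choice ex.
have [_ _ onto _] := phi_aut; have [v [vG e]] := onto _ (wr_elt_mem s 0).
have [t ev] := wr_elt_surj vG; exists t.
have v20 : v.2 = 0.
  by rewrite -[v.2]mulmx1 -AA' mulmxA -(trA t) /tr -ev e mul0mx.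
by move: e; rewrite ev v20 fE => /wr_elt_inj [].
Qed.

Lemma exists_cocycle : exists c, forall s x, phi (wr_elt s x) = wr_elt (f s + c x) (x *m A).
Proof.
have ex x : exists t, phi (wr_elt 0 x) = wr_elt t (x *m A).
  have [t e] := wr_elt_surj (phi_mem (wr_elt_mem 0 x)); exists t.
  by rewrite {1}e -/(tr 0 x) trA.
have [c cP] := functional_choice _ ex.
exists c => s x; have := phiM s 0 0 x.
by rewrite fE cP !wr_eltM raddf0 addr0 !add0r shift0.
Qed.

Variable c : 'rV[int]_k -> Sig.
Hypothesis phiE : forall s x, phi (wr_elt s x) = wr_elt (f s + c x) (x *m A).

(** Apply [phi] to the product of [wr_elt 0 z] and [wr_elt << g *g 0 >> 0]; the cocycle value [c z]
    cancels since the base is abelian. *)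
Lemma base_aut_shift g z : f << g *g z >> = shift (z *m A) (f << g *g 0 >>).
Proof.
have := phiM 0 << g *g 0 >> z 0.
rewrite !wr_eltM !phiE !wr_eltM shiftU !addr0 => /wr_elt_inj [].
rewrite raddf0 !add0r raddfD /= => e _.
have c0 : c 0 = 0.
  have := phiE 0 0; rewrite raddf0 add0r mul0mx fE raddf0.
  by case/wr_elt_inj.
by move: e; rewrite c0 raddf0 addr0 addrC => /addrI.
Qed.

Variable L : list (wcarrier gT k).
Hypothesis LP : forall x, wr_mem G x ->
  exists y, List.In y L /\ wr_mem G y /\ twisted_conj G phi x y.

Lemma twisted_pigeonhole (t : nat -> wcarrier gT k) : (forall i, wr_mem G (t i)) ->
  exists (i j : 'I_(length L).+1) u x u' x', i <> j /\
    wmul (wmul (wr_elt u x) (t i)) (phi (winv (wr_elt u x))) =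
    wmul (wmul (wr_elt u' x') (t j)) (phi (winv (wr_elt u' x'))).
Proof.
move=> tG.
have [i|i [j [y [ij [g [gG e]] [h [hG e']]]]]] :=
    @list_pigeonhole _ L (fun i y => twisted_conj G phi (t i) y).
  by have [y [yL [_ tw]]] := LP (tG i); exists y.
have [u eu] := wr_elt_surj gG; have [u' eu'] := wr_elt_surj hG.
by exists i, j, u, g.2, u', h.2; rewrite -eu -eu' -e -e'.
Qed.

(** A nonzero [v] with [(1 - A) v^T = 0] makes [y v^T], for [y] the translation part, constant on
    twisted classes. Multiples of a basis vector at which [v] is nonzero then lie in distinct
    classes. *)
Lemma det_1sub_neq0 : \det (1%:M - A) != 0.
Proof.
apply/negP; rewrite -det_tr => /det0P [v v0 vA].
have [j vj] : exists j, v 0 j != 0.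
  apply: NNPP => no; case/eqP: v0; apply/rowP => j; rewrite [RHS]mxE.
  by apply/eqP; apply: contraT => h; case: no; exists j.
have [i|i [i' [u [x [u' [x' [ii' e]]]]]]] :=
    @twisted_pigeonhole (fun i => wr_elt 0 (Posz i *: delta_mx 0 j)).
  exact: wr_elt_mem.
apply: ii'; apply/val_inj => /=; apply/eqP; rewrite -(inj_eq (can_inj absz_nat)).
move: e; rewrite !wr_eltV !phiE !wr_eltM => /wr_elt_inj [_ e].
rewrite !mulNmx in e; have {}e := congr1 (fun y => y *m v^T) (addr_sub_cancel e).
have Av y : y *m A *m v^T = y *m v^T.
  have : y *m ((1%:M - A) *m v^T) = 0.
    by rewrite -[1%:M - A]trmxK -trmx_mul vA trmx0 mulmx0.
  by rewrite mulmxBl mul1mx mulmxBr mulmxA => /eqP; rewrite subr_eq0 => /eqP.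
move: e; rewrite -!mulmxBl !mulmxBl !Av subrr -mulmxBl -scalerBl -scalemxAl.
rewrite -rowE => /matrixP /(_ 0 0) /eqP; rewrite !mxE mulf_eq0 (negPf vj) orbF.
by rewrite subr_eq0.
Qed.

Lemma mulmx_1sub_inj : injective (fun y : 'rV[int]_k => y - y *m A).
Proof.
move=> y z e; apply/eqP; rewrite -subr_eq0.
have e0 : (y - z) *m (1%:M - A) = 0.
  rewrite mulmxBr mulmx1 mulmxBl opprD addrACA -opprD.
  by apply/eqP; rewrite subr_eq0 e.
have : (y - z) *m (1%:M - A) *m \adj (1%:M - A) = 0 by rewrite e0 mul0mx.
rewrite -mulmxA mul_mx_adj mul_mx_scalar => /eqP.
by rewrite scalemx_eq0 (negPf det_1sub_neq0).
Qed.

(** Translation parts force the two conjugators of base elements in one class to have the same [x].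
    After undoing the shift by [x], the cocycle terms agree and cancel. *)
Lemma base_coker (t : 'I_(length L).+1 -> Sig) :
  exists i j w, i <> j /\ t i - t j = w - f w.
Proof.
have [i|i [j [u [x [u' [x' [ij e]]]]]]] :=
    @twisted_pigeonhole (fun i => wr_elt (t (inord i)) 0).
  exact: wr_elt_mem.
move: e; rewrite !inord_val !wr_eltV !phiE !wr_eltM !mulNmx !addr0.
case/wr_elt_inj => e /mulmx_1sub_inj ex; rewrite -{x'}ex in e.
have shiftD (s1 s2 : Sig) : shift (- x) (s1 + s2) = shift (- x) s1 + shift (- x) s2.
  exact: raddfD (shift (- x)) s1 s2.
have shiftK (s1 : Sig) : shift (- x) (shift x s1) = s1.
  by rewrite shift_shift addNr shift0.
have unshift (s1 s2 s3 : Sig) :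
    shift (- x) (s1 + shift x s2 + shift x s3) = shift (- x) s1 + s2 + s3.
  apply: etrans (shiftD _ _) (congr2 +%R _ (shiftK s3)).
  exact: etrans (shiftD _ _) (congr2 +%R erefl (shiftK s2)).
have {e} := etrans (esym (unshift _ _ _)) (etrans (congr1 (shift (- x)) e) (unshift _ _ _)).
move: (shift (- x) u) (shift (- x) u') => v v'.
rewrite (raddfN f v) (raddfN f v') !addrA => /addIr e.
exists i, j, (v' - v); split=> //; rewrite (addr_sub_cancel e) (raddfB f).
by rewrite [RHS]addrC !opprB.
Qed.

End Transport.

Lemma no_finite_reidemeister (gT : finGroupType) (G : {group gT}) (abG : abelian G)
    (k p r : nat) (lam : gT -> 'F_p) (a : gT) (phi : wcarrier gT k -> wcarrier gT k)
    (L : list (wcarrier gT k)) :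
  (0 < k)%N -> prime p -> (p == 2)%N || ((p == 3)%N && odd k) ->
  a \in G -> lam a = 1 -> (a ^+ (p ^ r) = 1)%g ->
  {in G &, forall g h, lam (g * h)%g = lam g + lam h} ->
  {in G, forall g, (g ^+ (p ^ r.-1) = 1)%g -> lam g = 0} ->
  {in G, forall g, (g ^+ (p ^ r) = 1)%g -> lam g = 0 ->
     exists c d, [/\ c \in G, d \in G, g = (c * d ^+ p)%g & (c ^+ (p ^ r.-1) = 1)%g]} ->
  wr_aut G phi ->
  (forall x, wr_mem G x -> exists y, List.In y L /\ wr_mem G y /\ twisted_conj G phi x y) ->
  False.
Proof.
move=> k_gt0 p_pr hp aG lam_a a_tors lamD lam_low lam_ker phi_aut LP.
pose lamV (x : additive_subg abG) := lam (abval x).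
have lamV_add : additive lamV.
  move=> x y; apply: (addIr (lamV y)); rewrite subrK.
  have := lamD _ _ (abval_mem (x - y)) (abval_mem y).
  by rewrite -abvalD subrK => e; rewrite /lamV -e.
pose lamA : {additive additive_subg abG -> 'F_p} :=
  HB.pack lamV (GRing.isAdditive.Build _ _ lamV lamV_add).
have [a' ea] := abval_surj abG aG.
have [A trA] := exists_translation_matrix abG phi_aut.
have [A' AA'] := exists_inverse_matrix phi_aut trA.
have [f fE] := exists_base_aut abG phi_aut.
have [c phiE] := exists_cocycle phi_aut trA fE.
have detA := det_1sub_neq0 phiE LP.
have cok := base_coker phiE LP.
have [g gK] := base_aut_surj phi_aut trA fE AA'.
have fU := base_aut_shift phi_aut fE phiE.
(* The coefficient group is [subg_of G] by definition, so identities give the bijection with a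
   finite type. *)
have fix_pts := @finite_fixed_points _ _ A f (subg_of G) id id
  (fun=> erefl) (fun=> erefl) fU _ cok.
have p0 : p%:R = 0 :> 'F_p by apply: pchar_Fp_0.
have F_nat (x : 'F_p) : exists n, x = n%:R by exists x; rewrite natr_Zp.
apply: (@coker_not_finite _ _ k A A' k_gt0 AA' detA f g (base_aut_inj phi_aut fE) gK fU
  p r lamA a' p0 F_nat _ _ _ _ _ cok fix_pts hp).
- by rewrite /= /lamV ea.
- by apply: abval_inj; rewrite abvalMn ea a_tors.
- move=> x /(congr1 (@abval _ _ _)); rewrite abvalMn => e.
  by apply: lam_low; rewrite ?abval_mem.
move=> x /(congr1 (@abval _ _ _)); rewrite abvalMn => e lx.
have [u [v [uG vG ex eu]]] := lam_ker _ (abval_mem x) e lx.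
have [u' eu'] := abval_surj abG uG; have [v' ev'] := abval_surj abG vG.
exists u', v'; split; apply: abval_inj.
  by rewrite abvalD abvalMn eu' ev'.
by rewrite abvalMn eu'.
Qed.

End RInfinity.

(* A primary decomposition of the finite abelian group G is given by a list b
   of elements with G the internal direct product of the cyclic groups <[x]>,
   each of prime-power order > 1; the multiplicity d of Z_{p^r} is the number
   of x in b of order p^r. *)
Theorem theorem2 (gT : finGroupType) (G : {group gT}) (k : nat) :
  (1 <= k)%N ->
  abelian G ->
  (exists b : seq gT,
     [/\ (\big[dprod/1%g]_(x <- b) <[x]>)%g = G,
         all (fun x => (1 < #[x]%g)%N && (#[x]%g == (pdiv #[x]%g) ^ (logn (pdiv #[x]%g) #[x]%g))) b &
         exists p r : nat,
           [/\ prime p, (0 < r)%N,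
               count (fun x => #[x]%g == p ^ r) b = 1%N &
               (p == 2) || ((p == 3) && odd k)]]) ->
  R_infinity_wr k G.
Proof.
move=> k_gt0 abG [b [defG ord_b [p [r [p_pr r_gt0 cnt hp]]]]] phi phi_aut [L LP].
have [lam [a [[aG lam_a a_tors] lamD lam_low lam_ker]]] :=
  exists_ulm_coordinate p_pr r_gt0 defG abG ord_b cnt.
apply: (no_finite_reidemeister abG k_gt0 p_pr hp aG lam_a a_tors lamD lam_low lam_ker
  phi_aut LP).
Qed.
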